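(* Let $G_1\,{}_\alpha\diamond_\beta\,G_2$ be the doubly warped product of two weighted graphs with warping functions $\alpha:G_2\to(0,\infty)$, $\beta:G_1\to(0,\infty)$, let $x\in G_1$, $p\in G_2$, and let $\mathcal N_1,\mathcal N_2>0$ be real. Set $$\mathcal Q_1(c_1,c_2)=\tfrac12c_1^2\beta^{-2}\Delta^{G_2}\alpha^{-2}+|c_1c_2|\big(\beta^{-2}\mathrm D_x+\tfrac12\alpha^{-2}\Gamma^{G_1}(\beta^{-2})\big),$$ $$\mathcal Q_2(c_1,c_2)=\tfrac12c_2^2\alpha^{-2}\Delta^{G_1}\beta^{-2}+|c_1c_2|\big(\alpha^{-2}\mathrm D_p+\tfrac12\beta^{-2}\Gamma^{G_2}(\alpha^{-2})\big).$$ Below, saturation of $x$ is with respect to $\mathcal N_1$ in $G_1$ and saturation of $p$ with respect to $\mathcal N_2$ in $G_2$. (1) If both $x$ and $p$ are weakly curvature saturated, then $$\mathcal K_{(x,p)}(\mathcal N_1+\mathcal N_2)\le\max\big\{\alpha^{-2}\mathcal K_{G_1,x}(\mathcal N_1)+\alpha^2\mathcal Q_1(1,0),\ \beta^{-2}\mathcal K_{G_2,p}(\mathcal N_2)+\beta^2\mathcal Q_2(0,1)\big\}.$$ (2) If $x$ is weakly curvature saturated and $p$ is curvature un-saturated, then $$\mathcal K_{(x,p)}(\mathcal N_1+\mathcal N_2)\le\alpha^{-2}\mathcal K_{G_1,x}(\mathcal N_1)+\alpha^2\mathcal Q_1(1,0)+2\mathcal N_1^{-1}\mathcal N_2(\mathcal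 N_1+\mathcal N_2)^{-1}\mathrm D_x.$$ (3) If $x$ is curvature un-saturated and $p$ is weakly curvature saturated, then $$\mathcal K_{(x,p)}(\mathcal N_1+\mathcal N_2)\le\beta^{-2}\mathcal K_{G_2,p}(\mathcal N_2)+\beta^2\mathcal Q_2(0,1)+2\mathcal N_1\mathcal N_2^{-1}(\mathcal N_1+\mathcal N_2)^{-1}\mathrm D_p.$$ (4) If neither $x$ nor $p$ is strongly curvature saturated, then $$\mathcal K_{(x,p)}(\mathcal N_1+\mathcal N_2)\le\max\big\{\alpha^{-2}\mathcal K_{G_1,x}(\mathcal N_1)+\alpha^2\mathcal Q_1(1,1),\ \beta^{-2}\mathcal K_{G_2,p}(\mathcal N_2)+\beta^2\mathcal Q_2(1,1)\big\}.$$ (5) If both $x$ and $p$ are weakly curvature saturated but neither is strongly curvature saturated, then $$\mathcal K_{(x,p)}(\mathcal N_1+\mathcal N_2)\le\min\big\{\alpha^{-2}\mathcal K_{G_1,x}(\mathcal N_1)+\alpha^2\mathcal Q_1(1,0)+2\mathcal N_1^{-1}\mathcal N_2(\mathcal N_1+\mathcal N_2)^{-1}\mathrm D_x,\ \beta^{-2}\mathcal K_{G_2,p}(\mathcal N_2)+\beta^2\mathcal Q_2(0,1)+2\mathcal N_1\mathcal N_2^{-1}(\mathcal N_1+\mathcal N_2)^{-1}\mathrm D_p\big\}.$$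
   Context: A weighted graph $(G,\omega,m)$ consists of a countable vertex set $G$, nonnegative edge weights $\omega_{xy}$, not necessarily symmetric but with $\omega_{xy}=s(x,y)\omega_{yx}$ for some $s(x,y)\neq0$, and a vertex measure $m:G\to(0,\infty)$. Write $x\sim y$ if $\omega_{xy}>0$; every vertex has at least one neighbour and only finitely many. $\mathrm D_x=\mathrm{Deg}_G(x)=m(x)^{-1}\sum_{y\sim x}\omega_{xy}$. For $f:G\to\mathbb R$, $\Delta f(x)=m(x)^{-1}\sum_{y\sim x}(f(y)-f(x))\omega_{xy}$; $\Gamma(u,v)=\frac12(\Delta(uv)-v\Delta u-u\Delta v)$, $\Gamma_2(u,v)=\frac12(\Delta\Gamma(u,v)-\Gamma(\Delta u,v)-\Gamma(u,\Delta v))$, $\Gamma(f)=\Gamma(f,f)$, $\Gamma_2(f)=\Gamma_2(f,f)$. A superscript $G_i$ indicates the graph in which the operator is taken. For $\mathcal N\in(0,\infty]$ ($\infty^{-1}=0$), $\mathcal K_{G,x}(\mathcal N)$ is the largest $\mathcal K$ with $\Gamma_2(f)(x)\ge\mathcal N^{-1}(\Delta f(x))^2+\mathcal K\,\Gamma(f)(x)$ for all $f:G\to\mathbb R$. The doubly warped product $G_1\,{}_\alpha\diamond_\beta\,G_2$ of $(G_1,\omega^{G_1},m^{G_1})$ and $(G_2,\omega^{G_2},m^{G_2})$ is the Cartesian product graph on $G_1\times G_2$ with vertex measure $m((x,p))=m^{G_1}(x)m^{G_2}(p)$ and edge weights $\omega_{((x,p),(y,q))}=\delta_{pq}\,m^{G_2}(p)\,\alpha^{-2}(p)\,\omega^{G_1}_{xy}+\delta_{xy}\,m^{G_1}(x)\,\beta^{-2}(x)\,\omega^{G_2}_{pq}$.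 $\mathcal K_{(x,p)}$ is its curvature function at $(x,p)$. In all formulas $\alpha=\alpha(p)$, $\beta=\beta(x)$, $\Delta^{G_2}\alpha^{-2}$ and $\Gamma^{G_2}(\alpha^{-2})$ are evaluated at $p$, $\Delta^{G_1}\beta^{-2}$ and $\Gamma^{G_1}(\beta^{-2})$ at $x$, and $\mathrm D_x=\mathrm{Deg}_{G_1}(x)$, $\mathrm D_p=\mathrm{Deg}_{G_2}(p)$. A curvature maximizer at $z\in G$ (for $\mathcal N$) is a function $f:G\to\mathbb R$ with $\Gamma_2(f)(z)=\mathcal N^{-1}(\Delta f(z))^2+\mathcal K_{G,z}(\mathcal N)\Gamma(f)(z)$. The vertex $z$ is weakly $\mathcal N$-curvature saturated if there exists a curvature maximizer $f$ at $z$ with $\Delta f(z)=0$; strongly $\mathcal N$-curvature saturated if all curvature maximizers $f$ at $z$ satisfy $\Delta f(z)=0$; $\mathcal N$-curvature un-saturated if all curvature maximizers $f$ at $z$ satisfy $\Delta f(z)\ne0$.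
   Formalization: A curvature maximizer f at z is required to have Γ(f)(z) ≠ 0; otherwise f = 0 is a maximizer at every vertex, every vertex is weakly saturated, none is un-saturated, and (1) would be false (e.g. for suitable warpings of K₂ × K₂). *)

(* Defs.v *)
From HB Require Import structures.
From mathcomp Require Import all_boot all_order all_algebra.
From mathcomp Require Import all_classical all_reals all_analysis.

Set Implicit Arguments.
Unset Strict Implicit.
Unset Printing Implicit Defensive.

Import Order.TTheory GRing.Theory Num.Theory.

Local Open Scope classical_set_scope.
Local Open Scope ring_scope.

Record wgraph (R : realType) := WGraph {
  vertex :> countType;
  weight : vertex -> vertex -> R;
  vmeas : vertex -> R;
  weight_ge0 : forall x y, 0 <= weight x y;
  weight_sym : forall x y, exists2 s : R, s != 0 & weight x y = s * weight y x;
  vmeas_gt0 : forall x, 0 < vmeas x;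
  nbrs_neq0 : forall x, exists y, 0 < weight x y;
  nbrs_finite : forall x, finite_set [set y | 0 < weight x y] }.

Definition nbrs (R : realType) (G : wgraph R) (x : G) : set G :=
  [set y | 0 < weight x y].

Definition deg (R : realType) (G : wgraph R) (x : G) : R :=
  (vmeas x)^-1 * \sum_(y \in nbrs x) weight x y.

Definition lap (R : realType) (G : wgraph R) (f : G -> R) (x : G) : R :=
  (vmeas x)^-1 * \sum_(y \in nbrs x) (f y - f x) * weight x y.

Definition Gamma_bil (R : realType) (G : wgraph R) (u v : G -> R) (x : G) : R :=
  2^-1 * (lap (fun y => u y * v y) x - v x * lap u x - u x * lap v x).

Definition Gamma2_bil (R : realType) (G : wgraph R) (u v : G -> R) (x : G) : R :=
  2^-1 * (lap (Gamma_bil u v) x - Gamma_bil (lap u) v x - Gamma_bil u (lap v) x).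

Definition Gamma (R : realType) (G : wgraph R) (f : G -> R) : G -> R :=
  Gamma_bil f f.

Definition Gamma2 (R : realType) (G : wgraph R) (f : G -> R) : G -> R :=
  Gamma2_bil f f.

(* The inverse is taken in \bar R, so that +oo^-1 = 0. *)
Definition CD_at (R : realType) (G : wgraph R) (x : G) (N : \bar R) (K : R) :
    Prop :=
  forall f : G -> R,
    fine (N^-1)%E * lap f x ^+ 2 + K * Gamma f x <= Gamma2 f x.

(* For 0 < N <= +oo the admissible K form a nonempty closed down-set, by local
   finiteness, and it is bounded above as soon as x has a neighbour other than
   itself; the supremum is then the largest admissible K. *)
Definition curvature (R : realType) (G : wgraph R) (x : G) (N : \bar R) : R :=
  sup [set K : R | CD_at x N K].

(* The condition Gamma f z != 0 discards the functions that are constant on the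
   ball of radius 1 around z: the zero function satisfies the equation at every
   z and N, so without it every vertex would be weakly saturated and none
   un-saturated. *)
Definition curvature_maximizer (R : realType) (G : wgraph R) (z : G)
    (N : \bar R) (f : G -> R) : Prop :=
  Gamma f z != 0 /\
  Gamma2 f z = fine (N^-1)%E * lap f z ^+ 2 + curvature z N * Gamma f z.

Definition weakly_saturated (R : realType) (G : wgraph R) (z : G)
    (N : \bar R) : Prop :=
  exists2 f : G -> R, curvature_maximizer z N f & lap f z = 0.

Definition strongly_saturated (R : realType) (G : wgraph R) (z : G)
    (N : \bar R) : Prop :=
  forall f : G -> R, curvature_maximizer z N f -> lap f z = 0.

Definition unsaturated (R : realType) (G : wgraph R) (z : G)
    (N : \bar R) : Prop :=
  forall f : G -> R, curvature_maximizer z N f -> lap f z != 0.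

Definition invsq (R : realType) (T : Type) (a : T -> {posnum R}) (t : T) : R :=
  (a t)%:num ^- 2.

Section DoublyWarped.
Variables (R : realType) (G1 G2 : wgraph R).
Variables (alpha : G2 -> {posnum R}) (beta : G1 -> {posnum R}).

Definition dw_weight (u v : G1 * G2) : R :=
  (u.2 == v.2)%:R * vmeas u.2 * invsq alpha u.2 * weight u.1 v.1 +
  (u.1 == v.1)%:R * vmeas u.1 * invsq beta u.1 * weight u.2 v.2.

Definition dw_meas (u : G1 * G2) : R := vmeas u.1 * vmeas u.2.

Lemma invsq_gt0 (T : Type) (a : T -> {posnum R}) t : 0 < invsq a t.
Proof. by rewrite /invsq invr_gt0 exprn_gt0. Qed.

Lemma dw_coef1_ge0 (u v : G1 * G2) :
  0 <= (u.2 == v.2)%:R * vmeas u.2 * invsq alpha u.2.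
Proof. by rewrite !mulr_ge0 ?ler0n// (ltW (vmeas_gt0 _), ltW (invsq_gt0 _ _)). Qed.

Lemma dw_coef2_ge0 (u v : G1 * G2) :
  0 <= (u.1 == v.1)%:R * vmeas u.1 * invsq beta u.1.
Proof. by rewrite !mulr_ge0 ?ler0n// (ltW (vmeas_gt0 _), ltW (invsq_gt0 _ _)). Qed.

Lemma dw_weight_ge0 u v : 0 <= dw_weight u v.
Proof.
apply: addr_ge0; apply: mulr_ge0; rewrite ?weight_ge0//.
  exact: dw_coef1_ge0.
exact: dw_coef2_ge0.
Qed.

Lemma dw_weight_gt0 u v : (0 < dw_weight u v) =
  (u.2 == v.2) && (0 < weight u.1 v.1) || (u.1 == v.1) && (0 < weight u.2 v.2).
Proof.
have w1 := weight_ge0 u.1 v.1; have w2 := weight_ge0 u.2 v.2.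
rewrite lt0r dw_weight_ge0 andbT /dw_weight.
rewrite paddr_eq0; [|exact: mulr_ge0 (dw_coef1_ge0 _ _) _|
                    exact: mulr_ge0 (dw_coef2_ge0 _ _) _].
rewrite !mulf_eq0 !pnatr_eq0 !eqb0 !(gt_eqF (vmeas_gt0 _)).
by rewrite !(gt_eqF (invsq_gt0 _ _)) !orbF negb_and !negb_or !negbK !lt0r w1 w2 !andbT.
Qed.

Lemma weight_gt0C (G : wgraph R) (x y : G) : (0 < weight x y) = (0 < weight y x).
Proof.
have [s s0 e] := weight_sym x y.
by rewrite !lt0r !weight_ge0 !andbT e mulf_eq0 (negbTE s0).
Qed.

Lemma dw_weight_sym u v :
  exists2 s : R, s != 0 & dw_weight u v = s * dw_weight v u.
Proof.
have e : (0 < dw_weight u v) = (0 < dw_weight v u).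
  rewrite !dw_weight_gt0 (eq_sym u.1) (eq_sym u.2).
  by rewrite (weight_gt0C u.1) (weight_gt0C u.2).
have [p|/negP p] := boolP (0 < dw_weight v u).
  exists (dw_weight u v / dw_weight v u); last by rewrite divfK ?gt_eqF.
  by rewrite mulf_neq0 ?invr_neq0// gt_eqF// e.
exists 1; first exact: oner_neq0.
move: e; rewrite (negbTE (introN idP p)) => /negbT; move/negP: p.
rewrite -!leNgt => p q; rewrite mul1r.
by apply/eqP; rewrite eq_le !(le_trans p, le_trans q) ?dw_weight_ge0.
Qed.

Lemma dw_meas_gt0 u : 0 < dw_meas u.
Proof. by rewrite mulr_gt0 ?vmeas_gt0. Qed.

Lemma dw_nbrs_neq0 u : exists v, 0 < dw_weight u v.
Proof.
have [y xy] := nbrs_neq0 u.1.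
by exists (y, u.2); rewrite dw_weight_gt0 /= eqxx xy.
Qed.

Lemma dw_nbrs_finite u : finite_set [set v | 0 < dw_weight u v].
Proof.
pose A := (fun y => (y, u.2)) @` nbrs u.1.
pose B := (fun q => (u.1, q)) @` nbrs u.2.
apply: (@sub_finite_set _ _ (A `|` B)).
  move=> [y q] /=; rewrite dw_weight_gt0 /= => /orP[] /andP[/eqP <- h].
    by left; exists y.
  by right; exists q.
by rewrite finite_setU; split; apply: finite_image; exact: nbrs_finite.
Qed.

Definition doubly_warped : wgraph R :=
  @WGraph R (G1 * G2)%type dw_weight dw_meas dw_weight_ge0 dw_weight_sym
    dw_meas_gt0 dw_nbrs_neq0 dw_nbrs_finite.

Definition Q1 (x : G1) (p : G2) (c1 c2 : R) : R :=
  2^-1 * c1 ^+ 2 * invsq beta x * lap (invsq alpha) p +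
  `|c1 * c2| * (invsq beta x * deg x +
                2^-1 * invsq alpha p * Gamma (invsq beta) x).

Definition Q2 (x : G1) (p : G2) (c1 c2 : R) : R :=
  2^-1 * c2 ^+ 2 * invsq alpha p * lap (invsq beta) x +
  `|c1 * c2| * (invsq alpha p * deg p +
                2^-1 * invsq beta x * Gamma (invsq alpha) p).

End DoublyWarped.

(* Main.v *)
(** Every bound comes from testing the curvature-dimension inequality of the
    product on F(y, q) = c1 f(y) + c2 g(q), where f and g are curvature
    maximizers at x and p.  The Laplacian of F splits, and Gamma2 F is the sum
    of the two Gamma2 terms, of terms with the Laplacians of the squared
    inverse warpings, and of a cross term proportional to c1 c2.  If f is
    harmonic at x, then (c1, c2) = (1, 0) gives the bound by the first entry
    alone, and symmetrically for g; as the degrees are nonnegative, this is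
    enough for all the claims but the fourth.  For the fourth, c1 and c2 are
    chosen so that N2 c1 A(p) Lf(x) = N1 c2 B(x) Lg(p), where L denotes the
    Laplacians, A = alpha^-2 and B = beta^-2, and the cross term is absorbed by
    Cauchy-Schwarz. *)

Require Import Defs.
From mathcomp Require Import all_boot all_order all_algebra.
From mathcomp Require Import all_classical all_reals all_analysis.
From mathcomp Require Import ring lra.

Import Order.TTheory GRing.Theory Num.Theory.

Local Open Scope ring_scope.

(** * Neighbour sums, Cauchy-Schwarz estimates and test functions on one graph *)

Section WeightedGraph.
Variables (R : realType) (G : wgraph R).
Implicit Types (x y : G) (u v f h : G -> R) (k l : R).

(** Common form of [lap], [deg] and [Gamma_bil], so that linearity, monotonicity and Cauchy-Schwarz
    are proved once for all of them. *)
Definition nbr_sum x h : R :=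
  (vmeas x)^-1 * \sum_(y \in nbrs x) h y * weight x y.

Lemma in_nbrs x y : (y \in nbrs x) = (0 < weight x y).
Proof. by apply/idP/idP => [/set_mem|/mem_set]. Qed.

(** Non-neighbours have weight zero. In the product this replaces the cross-shaped neighbourhood by
    a rectangle, over which sums iterate. *)
Lemma nbr_sum_widen (s : seq G) x h : uniq s ->
  (forall y, 0 < weight x y -> y \in s) ->
  nbr_sum x h = (vmeas x)^-1 * \sum_(y <- s) h y * weight x y.
Proof.
move=> us sub; congr (_ * _).
rewrite (@fsbigE _ _ _ _ _ [seq y <- s | 0 < weight x y]) ?filter_uniq//.
- rewrite big_filter_cond; apply: big_rmcond_in => y ys.
  rewrite in_nbrs andbb -leNgt => w0.
  by have /eqP -> : weight x y == 0; rewrite ?mulr0// eq_le w0 weight_ge0.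
- by move=> y /=; rewrite mem_filter => /andP[].
- by move=> y /= w0; rewrite mem_filter w0 sub.
Qed.

Definition nbr_seq x : seq G := finmap.enum_fset (fset_set (nbrs x)).

Lemma nbr_sumE x h :
  nbr_sum x h = (vmeas x)^-1 * \sum_(y <- nbr_seq x) h y * weight x y.
Proof. by rewrite /nbr_sum fsbig_finite//; exact: nbrs_finite. Qed.

Lemma mem_nbr_seq x y : (y \in nbr_seq x) = (0 < weight x y).
Proof.
by rewrite in_fset_set ?in_nbrs//; exact: nbrs_finite.
Qed.

Lemma nbr_sum_lin x h f k l :
  nbr_sum x (fun y => k * h y + l * f y) =
  k * nbr_sum x h + l * nbr_sum x f.
Proof.
rewrite !nbr_sumE.
have -> : \sum_(y <- nbr_seq x) (k * h y + l * f y) * weight x y =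
    k * (\sum_(y <- nbr_seq x) h y * weight x y) +
    l * (\sum_(y <- nbr_seq x) f y * weight x y).
  by rewrite !big_distrr -big_split; apply: eq_bigr => y _ /=; ring.
by ring.
Qed.

Lemma le_nbr_sum x h f : (forall y, 0 < weight x y -> h y <= f y) ->
  nbr_sum x h <= nbr_sum x f.
Proof.
move=> hf; rewrite !nbr_sumE ler_wpM2l ?invr_ge0 ?(ltW (vmeas_gt0 _))//.
rewrite big_seq [leRHS]big_seq; apply: ler_sum => y; rewrite mem_nbr_seq => w.
by rewrite ler_wpM2r ?hf ?ltW.
Qed.

Lemma nbr_sum_ge0 x h : (forall y, 0 <= h y) -> 0 <= nbr_sum x h.
Proof.
move=> h0; rewrite nbr_sumE mulr_ge0 ?invr_ge0 ?(ltW (vmeas_gt0 _))//.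
by apply: sumr_ge0 => y _; rewrite mulr_ge0 ?weight_ge0.
Qed.

Lemma nbr_sum_cauchy_schwarz x u v :
  nbr_sum x (fun y => u y * v y) ^+ 2 <=
  nbr_sum x (fun y => u y ^+ 2) * nbr_sum x (fun y => v y ^+ 2).
Proof.
set P := nbr_sum x (fun y => u y ^+ 2).
set Q := nbr_sum x (fun y => v y ^+ 2).
set S := nbr_sum x (fun y => u y * v y).
have P0 : 0 <= P by apply: nbr_sum_ge0 => y; exact: sqr_ge0.
have Q0 : 0 <= Q by apply: nbr_sum_ge0 => y; exact: sqr_ge0.
have quad s t : 0 <= s ^+ 2 * P + t ^+ 2 * Q + 2 * s * t * S.
  suff <- : nbr_sum x (fun y => (s * u y + t * v y) ^+ 2) =
      s ^+ 2 * P + t ^+ 2 * Q + 2 * s * t * S.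
    by apply: nbr_sum_ge0 => y; exact: sqr_ge0.
  have -> : (fun y => (s * u y + t * v y) ^+ 2) = (fun y =>
      1 * (s ^+ 2 * u y ^+ 2 + t ^+ 2 * v y ^+ 2) + 2 * s * t * (u y * v y)).
    by apply/funext => y; ring.
  by rewrite !nbr_sum_lin mul1r.
have [Q1|Q1] := ltP 0 Q.
  (* The minimizing direction of the quadratic form, scaled by [Q] to avoid a division. *)
  have := quad Q (- S).
  have -> : Q ^+ 2 * P + (- S) ^+ 2 * Q + 2 * Q * - S * S =
    Q * (P * Q - S ^+ 2) by ring.
  by rewrite pmulr_rge0// subr_ge0.
have Q_eq0 : Q = 0 by apply/eqP; rewrite eq_le Q0 Q1.
(* For [Q = 0] the form is linear in [t]; this choice leaves [- (P + 2) * S ^+ 2], which forces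
   [S = 0]. *)
have := quad (- S) (P + 1); rewrite Q_eq0.
have -> : (- S) ^+ 2 * P + (P + 1) ^+ 2 * 0 + 2 * - S * (P + 1) * S =
  - ((P + 2) * S ^+ 2) by ring.
by rewrite oppr_ge0 pmulr_rle0//; lra.
Qed.

Lemma lapE f x : lap f x = nbr_sum x (fun y => f y - f x).
Proof. by []. Qed.

Lemma lap_lin u v k l c x :
  lap (fun y => k * u y + l * v y + c) x = k * lap u x + l * lap v x.
Proof.
rewrite !lapE -nbr_sum_lin; congr nbr_sum.
by apply/funext => y; ring.
Qed.

Lemma Gamma_bilE u v x :
  Gamma_bil u v x =
  2^-1 * nbr_sum x (fun y => (u y - u x) * (v y - v x)).
Proof.
have -> : (fun y => (u y - u x) * (v y - v x)) = (fun y =>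
    1 * (1 * (u y * v y - u x * v x) + - v x * (u y - u x)) +
    - u x * (v y - v x)).
  by apply/funext => y; ring.
by rewrite !nbr_sum_lin /Gamma_bil !lapE; ring.
Qed.

Lemma Gamma_bilC u v : Gamma_bil u v = Gamma_bil v u.
Proof.
apply/funext => x; rewrite !Gamma_bilE; congr (_ * _); congr nbr_sum.
by apply/funext => y; ring.
Qed.

Lemma Gamma_bil_lin u v h k l c x :
  Gamma_bil (fun y => k * u y + l * v y + c) h x =
  k * Gamma_bil u h x + l * Gamma_bil v h x.
Proof.
rewrite !Gamma_bilE.
have -> : (fun y => (k * u y + l * v y + c - (k * u x + l * v x + c)) *
                    (h y - h x)) =
    (fun y => k * ((u y - u x) * (h y - h x)) + l * ((v y - v x) * (h y - h x))).
  by apply/funext => y; ring.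
by rewrite nbr_sum_lin; ring.
Qed.

Lemma GammaE f x :
  Gamma f x = 2^-1 * nbr_sum x (fun y => (f y - f x) ^+ 2).
Proof. exact: Gamma_bilE. Qed.

Lemma Gamma_ge0 f x : 0 <= Gamma f x.
Proof.
rewrite GammaE mulr_ge0 ?invr_ge0 ?ler0n//.
by apply: nbr_sum_ge0 => y; exact: sqr_ge0.
Qed.

Lemma degE x : deg x = nbr_sum x (fun=> 1).
Proof.
by congr (_ * _); apply: eq_fsbigr => y _; rewrite mul1r.
Qed.

Lemma deg_ge0 x : 0 <= deg x.
Proof. by rewrite degE; apply: nbr_sum_ge0. Qed.

(** Cauchy-Schwarz against the constant function 1. *)
Lemma lap_sqr_le f x : lap f x ^+ 2 <= 2 * deg x * Gamma f x.
Proof.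
have := nbr_sum_cauchy_schwarz x (fun=> 1) (fun y => f y - f x).
have -> : (fun y => 1 * (f y - f x)) = (fun y => f y - f x).
  by apply/funext => y; rewrite mul1r.
rewrite -lapE expr1n -degE GammaE => /le_trans; apply.
by rewrite le_eqVlt; apply/orP; left; apply/eqP; field.
Qed.

Lemma Gamma_bil_sqr_le u v x :
  Gamma_bil u v x ^+ 2 <= Gamma u x * Gamma v x.
Proof.
rewrite Gamma_bilE !GammaE.
by have := nbr_sum_cauchy_schwarz x (fun y => u y - u x) (fun y => v y - v x); lra.
Qed.

Lemma Gamma2E f x :
  Gamma2 f x = 2^-1 * lap (Gamma f) x - Gamma_bil f (lap f) x.
Proof. by rewrite /Gamma2 /Gamma2_bil (Gamma_bilC (lap f)) /Gamma; field. Qed.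

(** An upper bound passes to [sup] only for a nonempty set, as [sup] of the empty set is the default
    0. Local finiteness provides [S], a common bound for the degrees of all neighbours of [x]. *)
Lemma CD_at_nonempty x (n : R) : 0 <= n -> exists K, CD_at x n%:E K.
Proof.
move=> n0; pose S := \sum_(y <- nbr_seq x) deg y.
have degS y : 0 < weight x y -> deg y <= S.
  rewrite -mem_nbr_seq => yx; rewrite /S (bigD1_seq y)//=; last exact: finmap.fset_uniq.
  by rewrite lerDl sumr_ge0// => z _; exact: deg_ge0.
(* The last summand pays for the dimension term through [lap_sqr_le]; the first is a lower bound for
   [Gamma2] alone. *)
exists (- (2^-1 * (S + 1 + deg x) + 2 * n^-1 * deg x)) => f; rewrite fine_invr.
have L2 := lap_sqr_le f x; have D0 := deg_ge0 x; have ni0 : 0 <= n^-1 by rewrite invr_ge0.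
suff : - (S + 1 + deg x) * Gamma f x + lap f x ^+ 2 <= 2 * Gamma2 f x by nra.
pose d y := f y - f x.
have -> : 2 * Gamma2 f x = nbr_sum x
    (fun y => 1 * (Gamma f y - Gamma f x) + - 1 * (d y * (lap f y - lap f x))).
  by rewrite nbr_sum_lin Gamma2E lapE Gamma_bilE; field.
(* With both sides written as neighbour sums, the terms in [Gamma f x] and [lap f x] cancel
   neighbour by neighbour, leaving an estimate of [d y * lap f y]. *)
have -> : - (S + 1 + deg x) * Gamma f x + lap f x ^+ 2 = nbr_sum x
    (fun y => 1 * (- (2^-1 * (S + 1)) * d y ^+ 2 + - Gamma f x * 1)
              + lap f x * d y).
  by rewrite !nbr_sum_lin -degE -lapE GammaE; field.
apply: le_nbr_sum => y xy.
have Dy := deg_ge0 y; have Gy := Gamma_ge0 f y; have Ly := lap_sqr_le f y.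
have DS := degS _ xy.
suff : d y * lap f y <= 2^-1 * (S + 1) * d y ^+ 2 + Gamma f y by lra.
(* Young's inequality with weight [deg y + 1], which is positive, then [lap_sqr_le] at [y]. *)
have : (deg y + 1) * (d y * lap f y) <=
    (deg y + 1) * (2^-1 * (deg y + 1) * d y ^+ 2 + Gamma f y).
  have : 0 <= ((deg y + 1) * d y - lap f y) ^+ 2 by exact: sqr_ge0.
  by lra.
rewrite ler_pM2l; last by lra.
move=> /le_trans; apply; rewrite lerD2r ler_wpM2r ?sqr_ge0//; lra.
Qed.

(** A single test function bounds every admissible [K], after division by its positive [Gamma]. *)
Lemma curvature_le x (n C : R) f : 0 <= n -> 0 < Gamma f x ->
  Gamma2 f x <= n^-1 * lap f x ^+ 2 + C * Gamma f x ->
  curvature x n%:E <= C.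
Proof.
move=> n0 Gf le; apply: ge_sup.
  by have [K] := CD_at_nonempty x n n0; exists K.
move=> K /(_ f); rewrite fine_invr => /le_trans /(_ le).
by rewrite lerD2l ler_pM2r.
Qed.

End WeightedGraph.

(** * The operators of the doubly warped product *)

Section DoublyWarpedCalculus.
Variables (R : realType) (G1 G2 : wgraph R).
Variables (alpha : G2 -> {posnum R}) (beta : G1 -> {posnum R}).

Local Notation G := (doubly_warped alpha beta).
Local Notation A := (invsq alpha).
Local Notation B := (invsq beta).

(** The vertex measure in each half of the weight cancels one factor of the product measure, leaving
    the inverse squared warping. *)
Lemma lap_doubly_warped (F : G -> R) (x : G1) (p : G2) :
  lap F (x, p) =
  A p * lap (fun y => F (y, p)) x + B x * lap (fun q => F (x, q)) p.
Proof.
(* The centre is added so that the rectangle contains both arms of the cross; [undup] covers the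
   case of a loop at [x]. *)
pose s1 : seq G1 := undup (x :: finmap.enum_fset (fset_set (nbrs x))).
pose s2 : seq G2 := undup (p :: finmap.enum_fset (fset_set (nbrs p))).
have us1 : uniq s1 by exact: undup_uniq.
have us2 : uniq s2 by exact: undup_uniq.
have xs1 : x \in s1 by rewrite mem_undup mem_head.
have ps2 : p \in s2 by rewrite mem_undup mem_head.
have ns1 y : 0 < weight x y -> y \in s1.
  move=> w; rewrite mem_undup inE in_fset_set; last exact: nbrs_finite.
  by rewrite in_nbrs w orbT.
have ns2 q : 0 < weight p q -> q \in s2.
  move=> w; rewrite mem_undup inE in_fset_set; last exact: nbrs_finite.
  by rewrite in_nbrs w orbT.
have m1 := vmeas_gt0 x; have m2 := vmeas_gt0 p.
rewrite !lapE (@nbr_sum_widen _ _ s1)// (@nbr_sum_widen _ _ s2)//.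
rewrite (@nbr_sum_widen _ G [seq (y, q) | y <- s1, q <- s2]); last 2 first.
- by rewrite allpairs_uniq// => -[? ?] [? ?].
- move=> [y q]; rewrite [weight _ _]/(dw_weight alpha beta (x, p) (y, q)).
  rewrite dw_weight_gt0/= => /orP[] /andP[/eqP <- w]; apply: allpairs_f => //.
    exact: ns1.
  exact: ns2.
rewrite big_allpairs_dep/=.
have -> : \sum_(y <- s1) \sum_(q <- s2)
    (F (y, q) - F (x, p)) * dw_weight alpha beta (x, p) (y, q) =
  vmeas p * A p * (\sum_(y <- s1) (F (y, p) - F (x, p)) * weight x y) +
  vmeas x * B x * (\sum_(q <- s2) (F (x, q) - F (x, p)) * weight p q).
  rewrite /dw_weight/=.
  (* The Kronecker delta in each half of the weight collapses one of the two sums. *)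
  under eq_bigr do (under eq_bigr do rewrite mulrDr); rewrite /=.
  under eq_bigr do rewrite big_split; rewrite big_split/=; congr (_ + _).
    rewrite big_distrr; apply: eq_bigr => y _ /=.
    rewrite (bigD1_seq p)//= big1; first by rewrite eqxx addr0 mul1r; ring.
    by move=> q /negbTE; rewrite eq_sym => ->; rewrite !mul0r mulr0.
  rewrite (bigD1_seq x)//= [X in _ + X]big1 ?addr0; last first.
    move=> y /negbTE; rewrite eq_sym => yx; apply: big1 => q _.
    by rewrite yx !mul0r mulr0.
  by rewrite big_distrr; apply: eq_bigr => q _ /=; rewrite eqxx mul1r; ring.
rewrite /dw_meas/=; field; by rewrite !gt_eqF.
Qed.

Lemma Gamma_bil_doubly_warped (F H : G -> R) (x : G1) (p : G2) :
  Gamma_bil F H (x, p) =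
  A p * Gamma_bil (fun y => F (y, p)) (fun y => H (y, p)) x +
  B x * Gamma_bil (fun q => F (x, q)) (fun q => H (x, q)) p.
Proof. by rewrite /Gamma_bil !lap_doubly_warped; ring. Qed.

Variables (f : G1 -> R) (g : G2 -> R) (c1 c2 : R).

Definition tensor_sum (z : G) : R := c1 * f z.1 + c2 * g z.2.
Local Notation F := tensor_sum.

(** The padding [0 * f y] gives the shape that [lap_lin] and [Gamma_bil_lin] rewrite. *)
Lemma tensor_sum_left q : (fun y => F (y, q)) =
  (fun y => c1 * f y + 0 * f y + c2 * g q).
Proof. by apply/funext => y; rewrite /tensor_sum/=; ring. Qed.

Lemma tensor_sum_right y : (fun q => F (y, q)) =
  (fun q => c2 * g q + 0 * g q + c1 * f y).
Proof. by apply/funext => q; rewrite /tensor_sum/=; ring. Qed.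

Lemma lap_tensor_sum y q :
  lap F (y, q) = c1 * A q * lap f y + c2 * B y * lap g q.
Proof. by rewrite lap_doubly_warped tensor_sum_left tensor_sum_right !lap_lin; ring. Qed.

Lemma Gamma_tensor_sum y q :
  Gamma F (y, q) = c1 ^+ 2 * A q * Gamma f y + c2 ^+ 2 * B y * Gamma g q.
Proof.
rewrite /Gamma Gamma_bil_doubly_warped tensor_sum_left tensor_sum_right !Gamma_bil_lin.
rewrite (Gamma_bilC _ _ f) (Gamma_bilC _ _ g) !Gamma_bil_lin.
by ring.
Qed.

(** Along a fibre, [Gamma F] and [lap F] also vary through the warping of the other factor: the
    former yields the Laplacians of the warpings, the latter the cross term. *)
Lemma Gamma2_tensor_sum x p :
  Gamma2 F (x, p) =
  c1 ^+ 2 * A p ^+ 2 * Gamma2 f x + c2 ^+ 2 * B x ^+ 2 * Gamma2 g p +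
  2^-1 * c2 ^+ 2 * A p * Gamma g p * lap B x +
  2^-1 * c1 ^+ 2 * B x * Gamma f x * lap A p -
  c1 * c2 * (A p * lap g p * Gamma_bil B f x + B x * lap f x * Gamma_bil A g p).
Proof.
rewrite Gamma2E lap_doubly_warped Gamma_bil_doubly_warped.
have -> : (fun y => Gamma F (y, p)) = (fun y =>
    c1 ^+ 2 * A p * Gamma f y + c2 ^+ 2 * Gamma g p * B y + 0).
  by apply/funext => y; rewrite Gamma_tensor_sum; ring.
have -> : (fun q => Gamma F (x, q)) = (fun q =>
    c2 ^+ 2 * B x * Gamma g q + c1 ^+ 2 * Gamma f x * A q + 0).
  by apply/funext => q; rewrite Gamma_tensor_sum; ring.
have -> : (fun y => lap F (y, p)) = (fun y =>
    c1 * A p * lap f y + c2 * lap g p * B y + 0).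
  by apply/funext => y; rewrite lap_tensor_sum; ring.
have -> : (fun q => lap F (x, q)) = (fun q =>
    c2 * B x * lap g q + c1 * lap f x * A q + 0).
  by apply/funext => q; rewrite lap_tensor_sum; ring.
rewrite !lap_lin tensor_sum_left tensor_sum_right !Gamma_bil_lin.
rewrite (Gamma_bilC _ _ f (fun=> _)) (Gamma_bilC _ _ g (fun=> _)) !Gamma_bil_lin !Gamma2E.
rewrite (Gamma_bilC _ _ (lap f)) (Gamma_bilC _ _ (lap g)).
by field.
Qed.

End DoublyWarpedCalculus.

(** * Curvature bounds from tensor sums of maximizers *)

Section CurvatureBounds.
Variables (R : realType) (G1 G2 : wgraph R).
Variables (alpha : G2 -> {posnum R}) (beta : G1 -> {posnum R}).
Variables (x : G1) (p : G2) (N1 N2 : R).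
Hypotheses (N1_gt0 : 0 < N1) (N2_gt0 : 0 < N2).

Local Notation G := (doubly_warped alpha beta).
Local Notation A := (invsq alpha p).
Local Notation B := (invsq beta x).
Local Notation K := (@curvature R G (x, p) (N1 + N2)%:E).
Local Notation K1 := (curvature x N1%:E).
Local Notation K2 := (curvature p N2%:E).
Local Notation bound1 c := (A * K1 + (alpha p)%:num ^+ 2 * Q1 alpha beta x p 1 c).
Local Notation bound2 c := (B * K2 + (beta x)%:num ^+ 2 * Q2 alpha beta x p c 1).

Lemma sqr_invsq (T : Type) (a : T -> {posnum R}) t :
  (a t)%:num ^+ 2 = (invsq a t)^-1.
Proof. by rewrite /invsq invrK. Qed.

Lemma maximizer_Gamma_gt0 (H : wgraph R) (z : H) N f :
  curvature_maximizer z N f -> 0 < Gamma f z.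
Proof. by case=> G0 _; rewrite lt0r G0 Gamma_ge0. Qed.

(** The test function is harmonic at [(x, p)], so both dimension terms vanish, passing from [N1] to
    [N1 + N2] costs nothing, and the test inequality is an equality. *)
Lemma curvature_le_left : weakly_saturated x N1%:E -> K <= bound1 0.
Proof.
rewrite sqr_invsq; case=> f fmax L0; have Gf := maximizer_Gamma_gt0 _ _ _ _ fmax.
case: fmax => _; rewrite L0 expr0n mulr0 add0r => G2f.
have A0 : 0 < A by exact: invsq_gt0.
apply: (curvature_le _ G (x, p) _ _ (tensor_sum _ G1 G2 alpha beta f (fun=> 0) 1 0)).
- by rewrite addr_ge0 ?ltW.
- rewrite Gamma_tensor_sum expr1n mul1r expr0n !mul0r addr0; exact: mulr_gt0.
rewrite Gamma_tensor_sum Gamma2_tensor_sum lap_tensor_sum L0 G2f /Q1.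
rewrite mulr0 normr0 le_eqVlt; apply/orP; left; apply/eqP; field.
by rewrite !gt_eqF// addr_gt0.
Qed.

Lemma curvature_le_right : weakly_saturated p N2%:E -> K <= bound2 0.
Proof.
rewrite sqr_invsq; case=> g gmax L0; have Gg := maximizer_Gamma_gt0 _ _ _ _ gmax.
case: gmax => _; rewrite L0 expr0n mulr0 add0r => G2g.
have B0 : 0 < B by exact: invsq_gt0.
apply: (curvature_le _ G (x, p) _ _ (tensor_sum _ G1 G2 alpha beta (fun=> 0) g 0 1)).
- by rewrite addr_ge0 ?ltW.
- rewrite Gamma_tensor_sum expr1n mul1r expr0n !mul0r add0r; exact: mulr_gt0.
rewrite Gamma_tensor_sum Gamma2_tensor_sum lap_tensor_sum L0 G2g /Q2.
rewrite mul0r normr0 le_eqVlt; apply/orP; left; apply/eqP; field.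
by rewrite !gt_eqF// addr_gt0.
Qed.

Lemma not_strongly_saturated (H : wgraph R) (z : H) N :
  ~ strongly_saturated z N ->
  exists2 f, curvature_maximizer z N f & lap f z != 0.
Proof. by move=> /existsNP[f /not_implyP[fmax /eqP L0]]; exists f. Qed.

Lemma curvature_le_max :
  ~ strongly_saturated x N1%:E -> ~ strongly_saturated p N2%:E ->
  K <= Num.max (bound1 1) (bound2 1).
Proof.
move=> /not_strongly_saturated[f fmax Lf] /not_strongly_saturated[g gmax Lg].
have Gf := maximizer_Gamma_gt0 _ _ _ _ fmax.
have Gg := maximizer_Gamma_gt0 _ _ _ _ gmax.
case: fmax gmax => _; rewrite fine_invr => G2f [_]; rewrite fine_invr => G2g.
have A0 : 0 < A by exact: invsq_gt0.
have B0 : 0 < B by exact: invsq_gt0.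
set c1 := N1 * B * lap g p; set c2 := N2 * A * lap f x.
apply: (curvature_le _ G (x, p) _ _ (tensor_sum _ G1 G2 alpha beta f g c1 c2)).
- by rewrite addr_ge0 ?ltW.
(* Failure of strong saturation makes both Laplacians nonzero, hence both coefficients, and
   [Gamma F] is positive. *)
- have c1_neq0 : c1 != 0 by rewrite /c1 mulf_neq0// mulf_neq0// gt_eqF.
  have c2_neq0 : c2 != 0 by rewrite /c2 mulf_neq0// mulf_neq0// gt_eqF.
  rewrite Gamma_tensor_sum; apply: addr_gt0;
    by apply: mulr_gt0 => //; apply: mulr_gt0 => //; rewrite exprn_even_gt0.
set M := Num.max _ _.
have M1 : bound1 1 <= M by rewrite le_max lexx.
have M2 : bound2 1 <= M by rewrite le_max lexx orbT.
rewrite Gamma_tensor_sum Gamma2_tensor_sum lap_tensor_sum G2f G2g.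
(* The choice of c1 and c2 turns the convexity inequality
   [(u + v)^2 / (N1 + N2) <= u^2 / N1 + v^2 / N2] into an equality. *)
have lap_sqrE : c1 ^+ 2 * A ^+ 2 * (N1^-1 * lap f x ^+ 2) +
    c2 ^+ 2 * B ^+ 2 * (N2^-1 * lap g p ^+ 2) =
    (N1 + N2)^-1 * (c1 * A * lap f x + c2 * B * lap g p) ^+ 2.
  by rewrite /c1 /c2; field; rewrite !gt_eqF// addr_gt0.
(* Expanding a square splits the product; the degree part goes to [bound2 1] and the
   [Gamma (invsq beta)] part to [bound1 1]. In [cross2] the roles are exchanged. *)
have cross1 : - (c1 * c2 * (lap g p * Gamma_bil (invsq beta) f x)) <=
    c2 ^+ 2 * deg p * Gamma g p + 2^-1 * c1 ^+ 2 * Gamma (invsq beta) x * Gamma f x.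
  have := sqr_ge0 (c2 * lap g p + c1 * Gamma_bil (invsq beta) f x).
  have := ler_wpM2l (sqr_ge0 c2) (lap_sqr_le _ _ g p).
  have := ler_wpM2l (sqr_ge0 c1) (Gamma_bil_sqr_le _ _ (invsq beta) f x).
  by lra.
have cross2 : - (c1 * c2 * (lap f x * Gamma_bil (invsq alpha) g p)) <=
    c1 ^+ 2 * deg x * Gamma f x + 2^-1 * c2 ^+ 2 * Gamma (invsq alpha) p * Gamma g p.
  have := sqr_ge0 (c1 * lap f x + c2 * Gamma_bil (invsq alpha) g p).
  have := ler_wpM2l (sqr_ge0 c1) (lap_sqr_le _ _ f x).
  have := ler_wpM2l (sqr_ge0 c2) (Gamma_bil_sqr_le _ _ (invsq alpha) g p).
  by lra.
(* Each bound is weighted by its share of [Gamma F]; the maximum dominates the weighted average. *)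
have {}M1 : c1 ^+ 2 * A * Gamma f x * bound1 1 <= c1 ^+ 2 * A * Gamma f x * M.
  by apply: ler_wpM2l => //; exact: mulr_ge0 (mulr_ge0 (sqr_ge0 _) (ltW A0)) (ltW Gf).
have {}M2 : c2 ^+ 2 * B * Gamma g p * bound2 1 <= c2 ^+ 2 * B * Gamma g p * M.
  by apply: ler_wpM2l => //; exact: mulr_ge0 (mulr_ge0 (sqr_ge0 _) (ltW B0)) (ltW Gg).
have E1 : c1 ^+ 2 * A * Gamma f x * bound1 1 = c1 ^+ 2 * Gamma f x *
    (A ^+ 2 * K1 + 2^-1 * B * lap (invsq alpha) p + B * deg x +
     2^-1 * A * Gamma (invsq beta) x).
  by rewrite sqr_invsq /Q1 mulr1 normr1; field; rewrite gt_eqF.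
have E2 : c2 ^+ 2 * B * Gamma g p * bound2 1 = c2 ^+ 2 * Gamma g p *
    (B ^+ 2 * K2 + 2^-1 * A * lap (invsq beta) x + A * deg p +
     2^-1 * B * Gamma (invsq alpha) p).
  by rewrite sqr_invsq /Q2 mulr1 normr1; field; rewrite gt_eqF.
have := ler_wpM2l (ltW A0) cross1; have := ler_wpM2l (ltW B0) cross2.
by lra.
Qed.

End CurvatureBounds.

(** * The five claims, assembled from the three bounds *)

Theorem theorem1p15 (R : realType) (G1 G2 : wgraph R)
    (alpha : G2 -> {posnum R}) (beta : G1 -> {posnum R})
    (x : G1) (p : G2) (N1 N2 : R) (N1_gt0 : 0 < N1) (N2_gt0 : 0 < N2) :
  let a := (alpha p)%:num in
  let b := (beta x)%:num in
  let K1 := curvature x N1%:E in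
  let K2 := curvature p N2%:E in
  let K := @curvature R (doubly_warped alpha beta) (x, p) (N1 + N2)%:E in
  let Q1 := Q1 alpha beta x p in
  let Q2 := Q2 alpha beta x p in
  (weakly_saturated x N1%:E /\ weakly_saturated p N2%:E ->
     K <= Num.max (a ^- 2 * K1 + a ^+ 2 * Q1 1 0)
                  (b ^- 2 * K2 + b ^+ 2 * Q2 0 1)) /\
  (weakly_saturated x N1%:E /\ unsaturated p N2%:E ->
     K <= a ^- 2 * K1 + a ^+ 2 * Q1 1 0
          + 2 * N1^-1 * N2 * (N1 + N2)^-1 * deg x) /\
  (unsaturated x N1%:E /\ weakly_saturated p N2%:E ->
     K <= b ^- 2 * K2 + b ^+ 2 * Q2 0 1
          + 2 * N1 * N2^-1 * (N1 + N2)^-1 * deg p) /\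
  (~ strongly_saturated x N1%:E /\ ~ strongly_saturated p N2%:E ->
     K <= Num.max (a ^- 2 * K1 + a ^+ 2 * Q1 1 1)
                  (b ^- 2 * K2 + b ^+ 2 * Q2 1 1)) /\
  ((weakly_saturated x N1%:E /\ weakly_saturated p N2%:E) /\
   (~ strongly_saturated x N1%:E /\ ~ strongly_saturated p N2%:E) ->
     K <= Num.min (a ^- 2 * K1 + a ^+ 2 * Q1 1 0
                   + 2 * N1^-1 * N2 * (N1 + N2)^-1 * deg x)
                  (b ^- 2 * K2 + b ^+ 2 * Q2 0 1
                   + 2 * N1 * N2^-1 * (N1 + N2)^-1 * deg p)).
Proof.
move=> a b K1 K2 K Q1' Q2'.
have leftP := curvature_le_left R G1 G2 alpha beta x p N1 N2 N1_gt0 N2_gt0.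
have rightP := curvature_le_right R G1 G2 alpha beta x p N1 N2 N1_gt0 N2_gt0.
have slack1 : 0 <= 2 * N1^-1 * N2 * (N1 + N2)^-1 * deg x.
  by apply: mulr_ge0 (deg_ge0 _ _ _); rewrite !mulr_ge0 ?invr_ge0 ?addr_ge0 ?ltW.
have slack2 : 0 <= 2 * N1 * N2^-1 * (N1 + N2)^-1 * deg p.
  by apply: mulr_ge0 (deg_ge0 _ _ _); rewrite !mulr_ge0 ?invr_ge0 ?addr_ge0 ?ltW.
split; first by case=> /leftP le1 _; rewrite le_max; apply/orP; left.
split; first by case=> /leftP le1 _; apply: le_trans le1 _; rewrite lerDl.
split; first by case=> _ /rightP le2; apply: le_trans le2 _; rewrite lerDl.
split; first by case=> ss1 ss2; exact: curvature_le_max.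
case=> -[/leftP le1 /rightP le2] _; rewrite le_min.
by apply/andP; split; [apply: le_trans le1 _|apply: le_trans le2 _]; rewrite lerDl.
Qed.
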